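(* Let $\kappa$ be a field, let $A \leq \kappa^\times$ be a subgroup, let $R$ be a rack, and let $c \colon R \times R \to A$ be a $2$-cocycle. Then $$(r,a)^{(s,b)} = (r^s, c(r,s) \cdot a), \qquad r,s \in R, \quad a,b \in A,$$ endows $R \times A$ with a rack structure, denoted $R_c$. The association $(R,c) \mapsto R_c$ extends to a functor from the category of racks equipped with $A$-valued $2$-cocycles (with cocyclic morphisms) to the category of racks. Also, the rack $R_c$ is a quandle if and only if $R$ is a quandle and $c(r,r) = 1$ for every $r \in R$. Moreover, if $A$ is finite, there is an injective morphism of braided vector spaces $\iota\colon\kappa R(c) \to \kappa R_c$ mapping every $r \in R$ to $\sum_{a \in A} a^{-1} \cdot (r,a) \in \kappa R_c$; and if $h \colon \kappa R(c) \to V$ is a morphism of braided vector spaces over $\kappa$, then there exists a morphism of braided vector spaces $\tilde h\colon\kappa R_c \to V$ with $\tilde h \circ \iota = h$.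
   Context: A rack is a set $R$ with a binary operation $(x,y) \mapsto x^y$ such that for every $y \in R$ the map $x \mapsto x^y$ is a bijection on $R$, and $(x^y)^z = (x^z)^{y^z}$ for all $x,y,z \in R$; a morphism of racks is a map with $f(x^y) = f(x)^{f(y)}$. A rack is a quandle if $r^r = r$ for all $r$. A $2$-cocycle of $R$ over $\kappa$ is a function $c \colon R \times R \to \kappa^\times$ with $c(r,s)\, c(r^s,t) = c(r,t)\, c(r^t,s^t)$ for all $r,s,t \in R$. A morphism of racks $f \colon (R,c) \to (S,d)$ between racks with $2$-cocycles is cocyclic if $c(x,y) = d(f(x),f(y))$ for all $x,y \in R$. A braided vector space is a $\kappa$-vector space $V$ with an isomorphism $T_V \colon V \otimes V \to V \otimes V$ satisfying $(\mathrm{id} \otimes T)(T \otimes \mathrm{id})(\mathrm{id} \otimes T) = (T \otimes \mathrm{id})(\mathrm{id} \otimes T)(T \otimes \mathrm{id})$; a morphism of braided vector spaces is a linear map $f \colon V \to W$ with $T_W (f \otimes f) = (f \otimes f) T_V$. For a rack $R$ with $2$-cocycle $c$, $\kappa R(c)$ is the vector space with basis $R$ braided by $T(x \otimes y) = c(x,y)\, y \otimes x^y$; $\kappa R$ denotes $\kappa R(c)$ with $c = 1$. *)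

(* Defs.v *)
(* The K-module with basis a choiceType X is {malg K[X]}, with << x >> the basis
   vector of x.  Tensor products are quotients of such modules; the operations
   on them are locked so that unification does not unfold the quotient. *)
From HB Require Import structures.
From mathcomp Require Import all_boot all_order all_algebra.
From mathcomp Require Import generic_quotient ring_quotient.
From mathcomp Require Import boolp finmap.
From mathcomp.multinomials Require Import monalg.

Set Implicit Arguments.
Unset Strict Implicit.
Unset Printing Implicit Defensive.

Import GRing.Theory.

Local Open Scope ring_scope.

HB.lock Definition malg_lift (K : fieldType) (X : choiceType) (U : lmodType K)
    (f : X -> U) (g : {malg K[X]}) : U :=
  \sum_(k <- msupp g) g@_k *: f k.

Section FreeModule.
Variables (K : fieldType) (X : choiceType) (U : lmodType K).
Implicit Type f : X -> U.

Lemma malg_liftEw f (g : {malg K[X]}) (D : {fset X}) :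
  (msupp g `<=` D)%fset -> malg_lift f g = \sum_(k <- D) g@_k *: f k.
Proof.
move=> sgD; rewrite malg_lift.unlock.
apply: (big_fset_incl _ sgD) => k _ kNg.
by rewrite mcoeff_outdom ?scale0r.
Qed.

Fact malg_lift_is_linear f : linear (malg_lift f).
Proof.
move=> a g h; pose D := (msupp g `|` msupp h)%fset.
have sgD : (msupp g `<=` D)%fset by rewrite fsubsetUl.
have shD : (msupp h `<=` D)%fset by rewrite fsubsetUr.
have sD : (msupp (a *: g + h) `<=` D)%fset.
  apply: fsubset_trans (msuppD_le _ _) _.
  by rewrite fsubUset shD andbT (fsubset_trans (msuppZ_le _ _)).
rewrite (malg_liftEw _ sgD) (malg_liftEw _ shD) (malg_liftEw _ sD).
rewrite scaler_sumr -big_split /=; apply: eq_bigr => k _.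
by rewrite mcoeffD mcoeffZ scalerDl scalerA.
Qed.

HB.instance Definition _ f :=
  GRing.isLinear.Build K {malg K[X]} U _ (malg_lift f) (malg_lift_is_linear f).

Lemma malg_liftU f x : malg_lift f << x >> = f x.
Proof.
by rewrite malg_lift.unlock msuppU oner_eq0 big_seq_fset1 mcoeffUU scale1r.
Qed.

Lemma malg_lift_fun f f' a g :
  malg_lift (fun x => a *: f x + f' x) g = a *: malg_lift f g + malg_lift f' g.
Proof.
rewrite malg_lift.unlock scaler_sumr -big_split /=; apply: eq_bigr => k _.
by rewrite scalerDr !scalerA mulrC.
Qed.

Lemma malg_basisE (g : {malg K[X]}) : g = \sum_(k <- msupp g) g@_k *: << k >>.
Proof.
rewrite {1}[g]monalgE; apply: eq_bigr => k _; apply/malgP => x.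
by rewrite mcoeffZ !mcoeffU mulrnAr mulr1.
Qed.

Lemma malg_linear_ext (f f' : {linear {malg K[X]} -> U}) :
  (forall x, f << x >> = f' << x >>) -> f =1 f'.
Proof.
move=> eff' g; rewrite [g]malg_basisE !linear_sum; apply: eq_bigr => k _.
by rewrite !linearZ /= eff'.
Qed.

End FreeModule.

Section FreeModule2.
Variables (K : fieldType) (X Y : choiceType) (U : lmodType K) (w : X -> Y -> U).

Definition malg_lift2 (g : {malg K[X]}) (h : {malg K[Y]}) : U :=
  malg_lift (fun x => malg_lift (w x) h) g.

Fact malg_lift2_is_bilinear : bilinear_for *:%R *:%R malg_lift2.
Proof.
split=> [h a g g'|g a h h']; rewrite /malg_lift2; first exact: linearP.
rewrite -malg_lift_fun; congr (malg_lift _ g).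
by apply/funext => x; rewrite linearP.
Qed.

HB.instance Definition _ := bilinear_isBilinear.Build K {malg K[X]} {malg K[Y]}
  U *:%R *:%R malg_lift2 malg_lift2_is_bilinear.

Lemma malg_lift2U x y : malg_lift2 << x >> << y >> = w x y.
Proof. by rewrite /malg_lift2 !malg_liftU. Qed.

End FreeModule2.

Section TensorType.
Variables (K : fieldType) (V W : lmodType K).

(* The submodule of K[V x W] spanned by the bilinearity relators; the tensor
   product of V and W is the quotient of K[V x W] by it. *)
Inductive tensor_rel : {malg K[(V * W)%type]} -> Prop :=
| tensor_rel0 : tensor_rel 0
| tensor_relP (a : K) s t :
    tensor_rel s -> tensor_rel t -> tensor_rel (a *: s + t)
| tensor_rel_l (a : K) v v' w :
    tensor_rel (<< (a *: v + v', w) >> - (a *: << (v, w) >> + << (v', w) >>))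
| tensor_rel_r (a : K) v w w' :
    tensor_rel (<< (v, a *: w + w') >> - (a *: << (v, w) >> + << (v, w') >>)).

Definition tensor_relb : {pred {malg K[(V * W)%type]}} :=
  fun t => `[< tensor_rel t >].

Fact tensor_relb_zmod : zmod_closed tensor_relb.
Proof.
split=> [|s t /asboolP Rs /asboolP Rt]; first exact/asboolP/tensor_rel0.
apply/asboolP; rewrite addrC -scaleN1r; exact: tensor_relP.
Qed.

HB.instance Definition _ :=
  GRing.isZmodClosed.Build {malg K[(V * W)%type]} tensor_relb tensor_relb_zmod.

Definition tensor : Type := Quotient.quot tensor_relb.
HB.instance Definition _ := GRing.Zmodule.on tensor.

End TensorType.

HB.lock Definition tensor_pi (K : fieldType) (V W : lmodType K) :
    {malg K[(V * W)%type]} -> tensor V W :=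
  \pi_(Quotient.quot (@tensor_relb K V W))%qT.

HB.lock Definition tensor_repr (K : fieldType) (V W : lmodType K)
    (t : tensor V W) : {malg K[(V * W)%type]} :=
  repr (t : Quotient.quot (@tensor_relb K V W)).

HB.lock Definition tensor_scale (K : fieldType) (V W : lmodType K) (a : K)
    (t : tensor V W) : tensor V W :=
  tensor_pi (a *: tensor_repr t).

HB.lock Definition tens (K : fieldType) (V W : lmodType K) (v : V) (w : W) :
    tensor V W :=
  tensor_pi << (v, w) >>.

HB.lock Definition tensor_lift (K : fieldType) (V W U : lmodType K)
    (b : {bilinear V -> W -> U}) (t : tensor V W) : U :=
  malg_lift (fun p : V * W => b p.1 p.2) (tensor_repr t).

Section TensorModule.
Variables (K : fieldType) (V W : lmodType K).

Local Notation tensor := (tensor V W).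
Local Notation tensor_rel := (@tensor_rel K V W).
Local Notation tensor_relb := (@tensor_relb K V W).
Local Notation tensor_pi := (@tensor_pi K V W).
Local Notation tensor_repr := (@tensor_repr K V W).
Local Notation tensor_scale := (@tensor_scale K V W).
Local Notation tens := (@tens K V W).

Lemma tensor_reprK : cancel tensor_repr tensor_pi.
Proof. rewrite tensor_pi.unlock tensor_repr.unlock; exact: reprK. Qed.

Lemma tensor_piE s t : tensor_pi s = tensor_pi t <-> tensor_rel (s - t).
Proof.
rewrite tensor_pi.unlock; split=> [/eqP|Rst]; last (apply/eqP; move: Rst).
  by rewrite -Quotient.idealrBE => /asboolP.
by move=> Rst; rewrite -Quotient.idealrBE; apply/asboolP.
Qed.

Fact tensor_pi_is_zmod_morphism : zmod_morphism tensor_pi.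
Proof. by move=> s t; rewrite tensor_pi.unlock raddfB. Qed.

HB.instance Definition _ :=
  GRing.isZmodMorphism.Build _ tensor tensor_pi tensor_pi_is_zmod_morphism.

Fact tensor_scale_pi a s : tensor_scale a (tensor_pi s) = tensor_pi (a *: s).
Proof.
rewrite tensor_scale.unlock; apply/tensor_piE; rewrite -scalerBr -[X in tensor_rel X]addr0.
apply: tensor_relP (tensor_rel0 V W); apply/tensor_piE; exact: tensor_reprK.
Qed.

Fact tensor_scaleA a b t :
  tensor_scale a (tensor_scale b t) = tensor_scale (a * b) t.
Proof. by rewrite -[t]tensor_reprK !tensor_scale_pi scalerA. Qed.

Fact tensor_scale1 : left_id 1 tensor_scale.
Proof. by move=> t; rewrite -[t]tensor_reprK tensor_scale_pi scale1r. Qed.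

Fact tensor_scaleDr : right_distributive tensor_scale +%R.
Proof.
move=> a s t; rewrite -[s]tensor_reprK -[t]tensor_reprK -raddfD.
by rewrite !tensor_scale_pi scalerDr raddfD.
Qed.

Fact tensor_scaleDl t : {morph tensor_scale^~ t : a b / a + b}.
Proof.
move=> a b; rewrite -[t]tensor_reprK !tensor_scale_pi.
by rewrite scalerDl raddfD.
Qed.

HB.instance Definition _ := GRing.Zmodule_isLmodule.Build K tensor
  tensor_scaleA tensor_scale1 tensor_scaleDr tensor_scaleDl.

Fact tensor_pi_is_scalable : scalable tensor_pi.
Proof. by move=> a s; rewrite -tensor_scale_pi. Qed.

HB.instance Definition _ :=
  GRing.isScalable.Build K _ tensor _ tensor_pi tensor_pi_is_scalable.

Fact tens_is_bilinear : bilinear_for *:%R *:%R tens.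
Proof.
split=> [w a v v'|v a w w']; rewrite tens.unlock -linearZ -raddfD /=.
  exact/tensor_piE/tensor_rel_l.
exact/tensor_piE/tensor_rel_r.
Qed.

HB.instance Definition _ := bilinear_isBilinear.Build K V W tensor
  *:%R *:%R tens tens_is_bilinear.

Lemma tensPl a v v' w : tens (a *: v + v') w = a *: tens v w + tens v' w.
Proof. exact: tens_is_bilinear.1. Qed.

Lemma tensPr a v w w' : tens v (a *: w + w') = a *: tens v w + tens v w'.
Proof. exact: tens_is_bilinear.2. Qed.

HB.instance Definition _ v :=
  GRing.isLinear.Build K W tensor _ (tens v) (fun a => tensPr a v).

Lemma tensor_linear_ext (U : lmodType K) (f f' : {linear tensor -> U}) :
  (forall v w, f (tens v w) = f' (tens v w)) -> f =1 f'.
Proof.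
move=> eff' t; rewrite -[t]tensor_reprK [tensor_repr t]malg_basisE.
rewrite !linear_sum; apply: eq_bigr => -[v w] _.
by move: (eff' v w); rewrite !linearZ /= tens.unlock => ->.
Qed.

Section UniversalProperty.
Variables (U : lmodType K) (b : {bilinear V -> W -> U}).

Let lift := malg_lift (fun p : V * W => b p.1 p.2).

Local Notation tensor_lift := (@tensor_lift K V W U b).

Fact tensor_lift_pi s : tensor_lift (tensor_pi s) = lift s.
Proof.
have lift0 t : tensor_rel t -> lift t = 0.
  elim=> [|a s1 s2 _ h1 _ h2|a v v' w|a v w w']; rewrite /lift.
  - exact: linear0.
  - by rewrite linearP /= -/lift h1 h2 scaler0 addr0.
  - by rewrite linearB linearP /= !malg_liftU /= linearPl subrr.
  - by rewrite linearB linearP /= !malg_liftU /= linearPr subrr.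
rewrite tensor_lift.unlock; apply/eqP; rewrite -subr_eq0 -linearB; apply/eqP/lift0.
apply/tensor_piE; exact: tensor_reprK.
Qed.

Fact tensor_lift_is_linear : linear tensor_lift.
Proof.
move=> a s t; rewrite -[s]tensor_reprK -[t]tensor_reprK -linearP /=.
by rewrite !tensor_lift_pi /lift linearP.
Qed.

HB.instance Definition _ :=
  GRing.isLinear.Build K tensor U _ tensor_lift tensor_lift_is_linear.

Lemma tensor_liftE v w : tensor_lift (tens v w) = b v w.
Proof. by rewrite tens.unlock tensor_lift_pi /lift malg_liftU. Qed.

End UniversalProperty.
End TensorModule.

Arguments tens {K V W}.

Section TensorMap.
Variables (K : fieldType) (V V' W W' : lmodType K).
Variables (f : {linear V -> V'}) (g : {linear W -> W'}).

Definition tmap_bil v w : tensor V' W' := tens (f v) (g w).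

Fact tmap_bil_is_bilinear : bilinear_for *:%R *:%R tmap_bil.
Proof.
by split=> [w a v v'|v a w w']; rewrite /tmap_bil linearP ?tensPl ?tensPr.
Qed.

HB.instance Definition _ := bilinear_isBilinear.Build K V W (tensor V' W')
  *:%R *:%R tmap_bil tmap_bil_is_bilinear.

End TensorMap.

HB.lock Definition tmap (K : fieldType) (V V' W W' : lmodType K)
    (f : {linear V -> V'}) (g : {linear W -> W'}) :
    {linear tensor V W -> tensor V' W'} :=
  tensor_lift (tmap_bil f g).

Lemma tmapE (K : fieldType) (V V' W W' : lmodType K) (f : {linear V -> V'})
    (g : {linear W -> W'}) v w : tmap f g (tens v w) = tens (f v) (g w).
Proof. by rewrite tmap.unlock; exact: tensor_liftE. Qed.

Section TensorAssoc.
Variables (K : fieldType) (U V W : lmodType K).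

Definition tassoc_in (w : W) (u : U) (v : V) : tensor U (tensor V W) :=
  tens u (tens v w).

Lemma tassoc_inE w u v : tassoc_in w u v = tens u (tens v w).
Proof. by []. Qed.

Fact tassoc_in_is_bilinear w : bilinear_for *:%R *:%R (tassoc_in w).
Proof.
split=> [v a u u'|u a v v']; rewrite /tassoc_in; first by rewrite tensPl.
by rewrite tensPl tensPr.
Qed.

HB.instance Definition _ w := bilinear_isBilinear.Build K U V
  (tensor U (tensor V W)) *:%R *:%R (tassoc_in w) (tassoc_in_is_bilinear w).

Definition tassoc_bil (t : tensor U V) (w : W) := tensor_lift (tassoc_in w) t.

Fact tassoc_bil_is_bilinear : bilinear_for *:%R *:%R tassoc_bil.
Proof.
split=> [w a s t|t a w w']; rewrite /tassoc_bil; first by rewrite linearP.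
pose h : {linear tensor U V -> tensor U (tensor V W)} :=
  a \*: tensor_lift (tassoc_in w) \+ tensor_lift (tassoc_in w').
rewrite -[RHS]/(h t); apply: tensor_linear_ext => u v /=.
by rewrite 3!tensor_liftE /= 3!tassoc_inE tensPr tensPr.
Qed.

HB.instance Definition _ := bilinear_isBilinear.Build K (tensor U V) W
  (tensor U (tensor V W)) *:%R *:%R tassoc_bil tassoc_bil_is_bilinear.

Definition tunassoc_in (u : U) (v : V) (w : W) : tensor (tensor U V) W :=
  tens (tens u v) w.

Lemma tunassoc_inE u v w : tunassoc_in u v w = tens (tens u v) w.
Proof. by []. Qed.

Fact tunassoc_in_is_bilinear u : bilinear_for *:%R *:%R (tunassoc_in u).
Proof.
split=> [w a v v'|v a w w']; rewrite /tunassoc_in; last by rewrite tensPr.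
by rewrite tensPr tensPl.
Qed.

HB.instance Definition _ u := bilinear_isBilinear.Build K V W
  (tensor (tensor U V) W) *:%R *:%R (tunassoc_in u) (tunassoc_in_is_bilinear u).

Definition tunassoc_bil (u : U) (t : tensor V W) :=
  tensor_lift (tunassoc_in u) t.

Fact tunassoc_bil_is_bilinear : bilinear_for *:%R *:%R tunassoc_bil.
Proof.
split=> [t a u u'|u a s t]; rewrite /tunassoc_bil; last by rewrite linearP.
pose h : {linear tensor V W -> tensor (tensor U V) W} :=
  a \*: tensor_lift (tunassoc_in u) \+ tensor_lift (tunassoc_in u').
rewrite -[RHS]/(h t); apply: tensor_linear_ext => v w /=.
by rewrite 3!tensor_liftE /= 3!tunassoc_inE tensPl tensPl.
Qed.

HB.instance Definition _ := bilinear_isBilinear.Build K U (tensor V W)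
  (tensor (tensor U V) W) *:%R *:%R tunassoc_bil tunassoc_bil_is_bilinear.

End TensorAssoc.

HB.lock Definition tassoc (K : fieldType) (U V W : lmodType K) :
    {linear tensor (tensor U V) W -> tensor U (tensor V W)} :=
  tensor_lift (@tassoc_bil K U V W).

HB.lock Definition tunassoc (K : fieldType) (U V W : lmodType K) :
    {linear tensor U (tensor V W) -> tensor (tensor U V) W} :=
  tensor_lift (@tunassoc_bil K U V W).

Section TensorAssocTheory.
Variables (K : fieldType) (U V W : lmodType K).

Lemma tassocE (u : U) (v : V) (w : W) :
  tassoc U V W (tens (tens u v) w) = tens u (tens v w).
Proof.
by rewrite tassoc.unlock /= tensor_liftE /= /tassoc_bil tensor_liftE.
Qed.

Lemma tunassocE (u : U) (v : V) (w : W) :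
  tunassoc U V W (tens u (tens v w)) = tens (tens u v) w.
Proof.
by rewrite tunassoc.unlock /= tensor_liftE /= /tunassoc_bil tensor_liftE.
Qed.

Lemma tensor3_linear_ext (X : lmodType K)
    (f f' : {linear tensor (tensor U V) W -> X}) :
  (forall u v w, f (tens (tens u v) w) = f' (tens (tens u v) w)) -> f =1 f'.
Proof.
move=> eff'; apply: tensor_linear_ext => t w.
pose g (h : {linear tensor (tensor U V) W -> X}) : {linear tensor U V -> X} :=
  h \o applyr tens w.
rewrite -[LHS]/(g f t) -[RHS]/(g f' t); apply: tensor_linear_ext => u v /=.
exact: eff'.
Qed.

Lemma tassocK : cancel (tassoc U V W) (tunassoc U V W).
Proof.
apply: (@tensor3_linear_ext _ (tunassoc U V W \o tassoc U V W) idfun).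
by move=> u v w /=; rewrite tassocE tunassocE.
Qed.

Lemma tunassocK : cancel (tunassoc U V W) (tassoc U V W).
Proof.
move=> t; rewrite -[LHS]/((tassoc U V W \o tunassoc U V W) t) -[RHS]/(idfun t).
apply: tensor_linear_ext => u s.
pose g (h : {linear tensor U (tensor V W) -> tensor U (tensor V W)}) :
  {linear tensor V W -> tensor U (tensor V W)} := h \o tens u.
rewrite -[LHS]/(g (tassoc U V W \o tunassoc U V W) s) -[RHS]/(g idfun s).
apply: tensor_linear_ext => v w /=.
by rewrite tunassocE tassocE.
Qed.

End TensorAssocTheory.

(* T (x) id and id (x) T, both acting on (V (x) V) (x) V. *)
HB.lock Definition braid_l (K : fieldType) (V : lmodType K)
    (T : {linear tensor V V -> tensor V V}) :
    {linear tensor (tensor V V) V -> tensor (tensor V V) V} :=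
  tmap T idfun.

HB.lock Definition braid_r (K : fieldType) (V : lmodType K)
    (T : {linear tensor V V -> tensor V V}) :
    {linear tensor (tensor V V) V -> tensor (tensor V V) V} :=
  tunassoc V V V \o tmap idfun T \o tassoc V V V.

Definition is_braiding (K : fieldType) (V : lmodType K)
    (T : {linear tensor V V -> tensor V V}) : Prop :=
  bijective T /\
  braid_r T \o braid_l T \o braid_r T =1 braid_l T \o braid_r T \o braid_l T.

Record braided_space (K : fieldType) := BraidedSpace {
  bs_sort :> lmodType K;
  braiding : {linear tensor bs_sort bs_sort -> tensor bs_sort bs_sort};
  braidingP : is_braiding braiding
}.

Definition braided_morphism (K : fieldType) (V W : braided_space K)
    (f : {linear V -> W}) : Prop :=
  braiding W \o tmap f f =1 tmap f f \o braiding V.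

(* op x y stands for x^y. *)
Definition is_rack (R : Type) (op : R -> R -> R) : Prop :=
  (forall y, bijective (op^~ y)) /\
  (forall x y z, op (op x y) z = op (op x z) (op y z)).

Record rack := Rack {
  rack_sort :> choiceType;
  rack_op : rack_sort -> rack_sort -> rack_sort;
  rackP : is_rack rack_op
}.

Arguments rack_op {r}.

Definition is_quandle (R : rack) : Prop := forall r : R, rack_op r r = r.

Definition is_rack_morphism (R S : rack) (f : R -> S) : Prop :=
  forall x y, f (rack_op x y) = rack_op (f x) (f y).

(* The first condition says that c takes values in the units of K. *)
Definition is_cocycle (K : fieldType) (R : rack) (c : R -> R -> K) : Prop :=
  (forall r s, c r s != 0) /\
  (forall r s t,
     c r s * c (rack_op r s) t = c r t * c (rack_op r t) (rack_op s t)).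

Record cocycle (K : fieldType) (R : rack) := Cocycle {
  cocycle_fun :> R -> R -> K;
  cocycleP : is_cocycle cocycle_fun
}.

Fact trivial_cocycleP (K : fieldType) (R : rack) :
  is_cocycle (fun _ _ : R => 1 : K).
Proof. by split=> // r s; exact: oner_neq0. Qed.

Definition trivial_cocycle (K : fieldType) (R : rack) : cocycle K R :=
  Cocycle (trivial_cocycleP K R).

(* T (x (x) y) = c(x,y) y (x) x^y *)
HB.lock Definition rack_braiding (K : fieldType) (R : rack) (c : cocycle K R) :
    {linear tensor {malg K[R]} {malg K[R]} -> tensor {malg K[R]} {malg K[R]}} :=
  tensor_lift (malg_lift2 (fun r s : R =>
    c r s *: tens (<< s >> : {malg K[R]}) (<< rack_op r s >> : {malg K[R]}))).

Section RackSpace.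
Variables (K : fieldType) (R : rack) (c : cocycle K R).

Local Notation KR := {malg K[R]}.
Local Notation rack_braiding := (rack_braiding c).

Lemma rack_braidingE (r s : R) :
  rack_braiding (tens << r >> << s >>) =
    c r s *: tens (<< s >> : KR) (<< rack_op r s >> : KR).
Proof. by rewrite rack_braiding.unlock /= tensor_liftE /= malg_lift2U. Qed.

Lemma tensor_malg_ext (U : lmodType K) (f f' : {linear tensor KR KR -> U}) :
  (forall r s : R, f (tens << r >> << s >>) = f' (tens << r >> << s >>)) ->
  f =1 f'.
Proof.
move=> eff'; apply: tensor_linear_ext => x y.
pose g (h : {linear tensor KR KR -> U}) : {linear KR -> U} :=
  h \o applyr tens y.
rewrite -[LHS]/(g f x) -[RHS]/(g f' x); apply: malg_linear_ext => r.
pose g' (h : {linear tensor KR KR -> U}) : {linear KR -> U} :=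
  h \o tens (<< r >> : KR).
rewrite -[LHS]/(g' f y) -[RHS]/(g' f' y); apply: malg_linear_ext => s /=.
exact: eff'.
Qed.

Lemma tensor3_malg_ext (U : lmodType K)
    (f f' : {linear tensor (tensor KR KR) KR -> U}) :
  (forall r s t : R, f (tens (tens << r >> << s >>) << t >>) =
                     f' (tens (tens << r >> << s >>) << t >>)) ->
  f =1 f'.
Proof.
move=> eff'; apply: tensor_linear_ext => x z.
pose g (h : {linear tensor (tensor KR KR) KR -> U}) :
  {linear tensor KR KR -> U} := h \o applyr tens z.
rewrite -[LHS]/(g f x) -[RHS]/(g f' x); apply: tensor_malg_ext => r s.
pose g' (h : {linear tensor (tensor KR KR) KR -> U}) : {linear KR -> U} :=
  h \o tens (tens (<< r >> : KR) (<< s >> : KR)).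
rewrite -[LHS]/(g' f z) -[RHS]/(g' f' z); apply: malg_linear_ext => t /=.
exact: eff'.
Qed.

Lemma braid_l_rackE (r s t : R) :
  braid_l rack_braiding (tens (tens << r >> << s >>) << t >>) =
    c r s *: tens (tens (<< s >> : KR) (<< rack_op r s >> : KR)) (<< t >> : KR).
Proof. by rewrite braid_l.unlock tmapE rack_braidingE -[RHS](linearZl_LR tens). Qed.

Lemma braid_r_rackE (r s t : R) :
  braid_r rack_braiding (tens (tens << r >> << s >>) << t >>) =
    c s t *: tens (tens (<< r >> : KR) (<< t >> : KR)) (<< rack_op s t >> : KR).
Proof.
rewrite braid_r.unlock /= tassocE tmapE rack_braidingE.
by rewrite linearZr_LR linearZ /= tunassocE.
Qed.

Fact rack_braidingP : is_braiding rack_braiding.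
Proof.
have [cN0 cE] := cocycleP c; have [opB opA] := rackP R.
split.
  have [inv invP] : {inv : R -> R -> R & forall y,
      cancel (rack_op^~ y) (inv y) /\ cancel (inv y) (rack_op^~ y)}.
    apply: (boolp.choice (P := fun (y : R) (g : R -> R) =>
      cancel (rack_op^~ y) g /\ cancel g (rack_op^~ y))) => y.
    by have [g gK Kg] := opB y; exists g.
  have [T' T'E] : {T' : {linear tensor KR KR -> tensor KR KR} &
      forall s t : R, T' (tens << s >> << t >>) =
        (c (inv s t) s)^-1 *: tens (<< inv s t >> : KR) (<< s >> : KR)}.
    exists (tensor_lift (malg_lift2 (fun s t : R => (c (inv s t) s)^-1 *:
      tens (<< inv s t >> : KR) (<< s >> : KR)))) => s t.
    by rewrite /= tensor_liftE /= malg_lift2U.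
  exists T'.
    apply: (tensor_malg_ext (f := T' \o rack_braiding) (f' := idfun)) => r s /=.
    rewrite rack_braidingE linearZ_LR T'E (invP s).1.
    by rewrite scalerA divff ?scale1r.
  apply: (tensor_malg_ext (f := rack_braiding \o T') (f' := idfun)) => s t /=.
  rewrite T'E linearZ_LR /= rack_braidingE (invP s).2.
  by rewrite scalerA mulVf ?scale1r.
apply: tensor3_malg_ext => r s t.
have ZL a x : braid_l rack_braiding (a *: x) = a *: braid_l rack_braiding x.
  exact: linearZ.
have ZR a x : braid_r rack_braiding (a *: x) = a *: braid_r rack_braiding x.
  exact: linearZ.
rewrite /=.
rewrite braid_l_rackE braid_r_rackE !(ZL, ZR).
rewrite braid_l_rackE braid_r_rackE !(ZL, ZR).
rewrite braid_l_rackE braid_r_rackE !scalerA (opA r s t); congr (_ *: _).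
by rewrite -mulrA -cE mulrC.
Qed.

End RackSpace.

Definition rack_space (K : fieldType) (R : rack) (c : cocycle K R) :
    braided_space K :=
  BraidedSpace (rack_braidingP c).

Definition rack_basis (K : fieldType) (R : rack) (c : cocycle K R) (r : R) :
    rack_space c :=
  (<< r >> : {malg K[R]}).

Record category := Category {
  cat_obj :> Type;
  cat_hom : cat_obj -> cat_obj -> Type;
  cat_id : forall X, cat_hom X X;
  cat_comp : forall X Y Z, cat_hom Y Z -> cat_hom X Y -> cat_hom X Z;
  cat_compIl : forall X Y (f : cat_hom X Y), cat_comp (cat_id Y) f = f;
  cat_compIr : forall X Y (f : cat_hom X Y), cat_comp f (cat_id X) = f;
  cat_compA : forall X Y Z T (f : cat_hom X Y) (g : cat_hom Y Z)
    (h : cat_hom Z T), cat_comp h (cat_comp g f) = cat_comp (cat_comp h g) f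
}.

Arguments cat_hom {c}.
Arguments cat_id {c}.
Arguments cat_comp {c X Y Z}.

Record functor (C D : category) := Functor {
  functor_obj :> C -> D;
  functor_hom : forall X Y : C,
    cat_hom X Y -> cat_hom (functor_obj X) (functor_obj Y);
  functor_id : forall X : C,
    functor_hom (cat_id X) = cat_id (functor_obj X);
  functor_comp : forall (X Y Z : C) (f : cat_hom X Y) (g : cat_hom Y Z),
    functor_hom (cat_comp g f) = cat_comp (functor_hom g) (functor_hom f)
}.

Record rack_hom (R S : rack) := RackHom {
  rack_hom_fun :> R -> S;
  rack_homP : is_rack_morphism rack_hom_fun
}.

Lemma rack_hom_eq (R S : rack) (f g : rack_hom R S) :
  rack_hom_fun f = rack_hom_fun g -> f = g.
Proof.
case: f g => [f fP] [g gP] /= fg; subst g.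
by rewrite (Prop_irrelevance fP gP).
Qed.

Fact rack_id_subproof (R : rack) : is_rack_morphism (@id R).
Proof. by []. Qed.

Fact rack_comp_subproof (R S T : rack) (g : rack_hom S T) (f : rack_hom R S) :
  is_rack_morphism (g \o f).
Proof. by move=> x y /=; rewrite !rack_homP. Qed.

Definition rack_id (R : rack) : rack_hom R R := RackHom (@rack_id_subproof R).

Definition rack_comp (R S T : rack) (g : rack_hom S T) (f : rack_hom R S) :
    rack_hom R T :=
  RackHom (rack_comp_subproof g f).

Fact rack_compIl (R S : rack) (f : rack_hom R S) : rack_comp (rack_id S) f = f.
Proof. exact: rack_hom_eq. Qed.

Fact rack_compIr (R S : rack) (f : rack_hom R S) : rack_comp f (rack_id R) = f.
Proof. exact: rack_hom_eq. Qed.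

Fact rack_compA (R S T U : rack) (f : rack_hom R S) (g : rack_hom S T)
    (h : rack_hom T U) :
  rack_comp h (rack_comp g f) = rack_comp (rack_comp h g) f.
Proof. exact: rack_hom_eq. Qed.

Definition rack_cat : category := Category rack_compIl rack_compIr rack_compA.

(* A subgroup of the units of K is encoded as a predicate A closed under 1 and
   division, subject to 0 \notin A where that is needed. *)
Section CocycleRacks.
Variables (K : fieldType) (A : divClosed K).

Record cocycle_rack := CocycleRack {
  cr_rack :> rack;
  cr_cocycle : cocycle K cr_rack;
  cr_cocycle_in : forall r s, cr_cocycle r s \in A
}.

Record cocyclic_hom (X Y : cocycle_rack) := CocyclicHom {
  cocyclic_hom_fun :> X -> Y;
  cocyclic_homP : is_rack_morphism cocyclic_hom_fun;
  cocyclic_homE : forall x y,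
    cr_cocycle X x y = cr_cocycle Y (cocyclic_hom_fun x) (cocyclic_hom_fun y)
}.

Lemma cocyclic_hom_eq (X Y : cocycle_rack) (f g : cocyclic_hom X Y) :
  cocyclic_hom_fun f = cocyclic_hom_fun g -> f = g.
Proof.
case: f g => [f fP fE] [g gP gE] /= fg; subst g.
by rewrite (Prop_irrelevance fP gP) (Prop_irrelevance fE gE).
Qed.

Definition cocyclic_id (X : cocycle_rack) : cocyclic_hom X X :=
  CocyclicHom (@rack_id_subproof X) (fun x y => erefl).

Fact cocyclic_comp_subproof1 (X Y Z : cocycle_rack) (g : cocyclic_hom Y Z)
  (f : cocyclic_hom X Y) : is_rack_morphism (g \o f).
Proof. by move=> x y /=; rewrite !cocyclic_homP. Qed.

Fact cocyclic_comp_subproof2 (X Y Z : cocycle_rack) (g : cocyclic_hom Y Z)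
    (f : cocyclic_hom X Y) x y :
  cr_cocycle X x y = cr_cocycle Z ((g \o f) x) ((g \o f) y).
Proof. by rewrite /= -!cocyclic_homE. Qed.

Definition cocyclic_comp (X Y Z : cocycle_rack) (g : cocyclic_hom Y Z)
    (f : cocyclic_hom X Y) : cocyclic_hom X Z :=
  CocyclicHom (cocyclic_comp_subproof1 g f) (cocyclic_comp_subproof2 g f).

Fact cocyclic_compIl (X Y : cocycle_rack) (f : cocyclic_hom X Y) :
  cocyclic_comp (cocyclic_id Y) f = f.
Proof. exact: cocyclic_hom_eq. Qed.

Fact cocyclic_compIr (X Y : cocycle_rack) (f : cocyclic_hom X Y) :
  cocyclic_comp f (cocyclic_id X) = f.
Proof. exact: cocyclic_hom_eq. Qed.

Fact cocyclic_compA (X Y Z T : cocycle_rack) (f : cocyclic_hom X Y)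
    (g : cocyclic_hom Y Z) (h : cocyclic_hom Z T) :
  cocyclic_comp h (cocyclic_comp g f) = cocyclic_comp (cocyclic_comp h g) f.
Proof. exact: cocyclic_hom_eq. Qed.

Definition cocycle_rack_cat : category :=
  Category cocyclic_compIl cocyclic_compIr cocyclic_compA.

Variable X : cocycle_rack.

Fact ext_op_subproof (r s : X) (a : {a : K | a \in A}) :
  cr_cocycle X r s * val a \in A.
Proof. by rewrite rpredM ?cr_cocycle_in ?(valP a). Qed.

(* (r,a)^(s,b) = (r^s, c(r,s) a) *)
Definition ext_op (p q : X * {a : K | a \in A}) : X * {a : K | a \in A} :=
  (rack_op p.1 q.1, exist (fun a => a \in A) _ (ext_op_subproof p.1 q.1 p.2)).

End CocycleRacks.

Arguments ext_op {K A} X.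

(* Main.v *)
Require Import Defs.
From mathcomp Require Import all_boot all_order all_algebra.
From mathcomp Require Import separable.
From mathcomp Require Import finmap monalg.
From mathcomp Require Import boolp classical_sets cardinality fsbigop.
Import GRing.Theory.
Local Open Scope ring_scope.
Set Implicit Arguments.
Unset Strict Implicit.
Unset Printing Implicit Defensive.

(** The rack axioms for R_c are those of R together with, in the second
    coordinate, the cocycle identity and the invertibility of the values of c;
    functoriality and the quandle criterion are read off from the formula for
    the operation.

    For the linear part, iota(r) is a weight vector for A acting on the second
    coordinate: the substitution a -> u a in its defining sum shows that moving
    that coordinate by u multiplies iota(r) by u ([sum_inv_shift]).  The
    braiding of K R_c sends (r,a) (x) (s,b) to (s,b) (x) (r^s, c(r,s) a), so on
    iota(r) (x) iota(s) the shift by c(r,s) comes out as the scalar c(r,s), which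
    is exactly the braiding of K R(c).

    Dually, a braided morphism h on K R(c) extends along iota by
      h~(r,a) = (a / |A|) h(r).
    It is braided because replacing a by c(r,s) a in the second coordinate
    produces the factor c(r,s) required by h, and h~ o iota = h because each of
    the |A| summands of iota(r) contributes h(r) / |A|.  The division is
    legitimate in every characteristic: with n = |A|, the n elements of A are
    roots of X^n - 1, which is therefore a product of distinct linear factors,
    hence separable, hence not of zero derivative n X^(n-1)
    ([size_mulr_stable_neq0]).  Taking h = id gives a left inverse of iota,
    hence its injectivity. *)

(** * Finite multiplicative subsets of a field *)

(** Lagrange's theorem, by the argument for abelian groups: multiplication by u
    permutes s, so the product of the elements of s is unchanged when each is
    multiplied by u. *)
Lemma expr_size_mulr_stable (K : fieldType) (s : seq K) (u : K) :
    uniq s -> 0 \notin s -> {in s &, forall a b, a * b \in s} -> u \in s ->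
  u ^+ size s = 1.
Proof.
move=> s_uniq s_N0 sM us.
have u_neq0 : u != 0 by apply: contraNneq s_N0 => <-.
have us_uniq : uniq [seq u * a | a <- s].
  by rewrite map_inj_in_uniq // => a b _ _; apply: mulfI.
have us_sub : {subset [seq u * a | a <- s] <= s}.
  by move=> _ /mapP[a sa ->]; apply: sM.
have [|_ us_s] := uniq_min_size us_uniq us_sub; first by rewrite size_map.
have prod_neq0 : \prod_(a <- s) a != 0.
  by rewrite prodf_seq_neq0; apply/allP => a sa; apply: contraNneq s_N0 => <-.
apply: (mulIf prod_neq0); rewrite mul1r.
rewrite -[RHS](perm_big _ (uniq_perm us_uniq s_uniq us_s)) big_map big_split /=.
by rewrite big_const_seq count_predT iter_mulr_1.
Qed.

(** A field of characteristic p has no nontrivial p-torsion in its unit group: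
    were the size n zero in K, the polynomial X^n - 1, which is the product of
    the X - a for a in s, would be separable with zero derivative. *)
Lemma size_mulr_stable_neq0 (K : fieldType) (s : seq K) :
    uniq s -> 0 \notin s -> {in s &, forall a b, a * b \in s} -> s != [::] ->
  (size s)%:R != 0 :> K.
Proof.
move=> s_uniq s_N0 sM; rewrite -size_eq0 -lt0n => s_gt0.
have size_p : size ('X^(size s) - 1 : {poly K}) = (size s).+1.
  by rewrite -polyC1 size_XnsubC.
have p_prod : 'X^(size s) - 1 = \prod_(a <- s) ('X - a%:P) :> {poly K}.
  rewrite [LHS](all_roots_prod_XsubC size_p).
  - by rewrite (monicP (monicXnsubC _ s_gt0)) scale1r.
  - apply/allP => a sa.
    by rewrite rootE !hornerE (expr_size_mulr_stable s_uniq) ?subrr.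
  - by rewrite uniq_rootsE.
have := separable_prod_XsubC s; rewrite s_uniq -p_prod => p_sep.
apply/negP => /eqP size0.
have := separable_deriv_eq0 p_sep (dvdpp _); rewrite size_p ltnS => /(_ s_gt0).
rewrite derivB derivXn -polyC1 derivC subr0 -mulr_natr -polyC_natr size0.
by rewrite mulr0 eqxx.
Qed.

Lemma card_finite_subgroup_neq0 (K : fieldType) (A : divClosed K) :
    0 \notin A -> finite_set [set: {a : K | a \in A}]%classic ->
  (size (fset_set [set: {a : K | a \in A}]%classic))%:R != 0 :> K.
Proof.
move=> A_N0 A_fin; pose D := fset_set [set: {a : K | a \in A}]%classic.
have inD a : a \in D by rewrite in_fset_set ?inE.
have memE x : (x \in [seq val a | a <- D]) = (x \in A).
  apply/mapP/idP => [[a _ ->]|xA]; first exact: valP.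
  by exists (exist _ x xA).
rewrite -(size_map val) size_mulr_stable_neq0 //.
- by rewrite map_inj_uniq ?fset_uniq //; apply: val_inj.
- by rewrite memE.
- by move=> a b; rewrite !memE; apply: rpredM.
- by apply/eqP => D0; have := memE 1; rewrite D0 rpred1.
Qed.

(** * The rack R_c *)

Section Extension.
Variables (K : fieldType) (A : divClosed K) (A_N0 : 0 \notin A).

Local Notation At := {a : K | a \in A}.

Lemma subgroup_neq0 (a : At) : val a != 0.
Proof. by apply: contraNneq A_N0 => <-; apply: valP. Qed.

Definition subgroup_mul (u a : At) : At :=
  exist (fun a => a \in A) _ (rpredM (valP u) (valP a)).

Definition subgroup_inv (u : At) : At :=
  exist (fun a => a \in A) _ (rpredVr (valP u)).

Lemma subgroup_mulVK u : cancel (subgroup_mul u) (subgroup_mul (subgroup_inv u)).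
Proof. by move=> a; apply: val_inj; rewrite /= mulKf ?subgroup_neq0. Qed.

Lemma subgroup_mulKV u : cancel (subgroup_mul (subgroup_inv u)) (subgroup_mul u).
Proof. by move=> a; apply: val_inj; rewrite /= mulVKf ?subgroup_neq0. Qed.

Lemma subgroup_mul_bij u : bijective (subgroup_mul u).
Proof. exact: Bijective (subgroup_mulVK u) (subgroup_mulKV u). Qed.

Definition cocycle_elt (X : cocycle_rack A) (r s : X) : At :=
  exist (fun a => a \in A) _ (cr_cocycle_in r s).

Lemma ext_opE (X : cocycle_rack A) (p q : X * At) :
  ext_op X p q = (rack_op p.1 q.1, subgroup_mul (cocycle_elt p.1 q.1) p.2).
Proof. by congr (_, _); apply: val_inj. Qed.

Lemma ext_rackP (X : cocycle_rack A) : is_rack (ext_op X).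
Proof.
have [_ cE] := cocycleP (cr_cocycle X); have [opB opA] := rackP X.
split=> [[s b]|[r a] [s b] [t d]]; last first.
  rewrite !ext_opE /= opA; congr (_, _); apply: val_inj => /=.
  by rewrite !mulrA [X in X * _ = _]mulrC cE [X in _ = X * _]mulrC.
have [inv opK invK] := opB s.
exists (fun p => (inv p.1,
    subgroup_mul (subgroup_inv (cocycle_elt (inv p.1) s)) p.2)).
  by case=> r a; rewrite ext_opE /= opK subgroup_mulVK.
by case=> r a; rewrite ext_opE /= invK subgroup_mulKV.
Qed.

Definition ext_rack (X : cocycle_rack A) : rack := Rack (ext_rackP X).

Definition ext_map (X Y : cocycle_rack A) (f : cocyclic_hom X Y)
    (p : ext_rack X) : ext_rack Y := (f p.1, p.2).

Lemma ext_mapP (X Y : cocycle_rack A) (f : cocyclic_hom X Y) :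
  is_rack_morphism (ext_map f).
Proof.
move=> p q; rewrite /= /ext_map !ext_opE /= cocyclic_homP.
by congr (_, _); apply: val_inj; rewrite /= (cocyclic_homE f).
Qed.

Lemma ext_functor_subproof :
  (forall X, RackHom (ext_mapP (cocyclic_id X)) = rack_id (ext_rack X)) /\
  (forall X Y Z (f : cocyclic_hom X Y) (g : cocyclic_hom Y Z),
     RackHom (ext_mapP (cocyclic_comp g f)) =
     rack_comp (RackHom (ext_mapP g)) (RackHom (ext_mapP f))).
Proof. by split=> *; apply: rack_hom_eq; apply/funext => -[]. Qed.

Definition ext_functor : functor (cocycle_rack_cat A) rack_cat :=
  @Functor (cocycle_rack_cat A) rack_cat ext_rack
    (fun X Y f => RackHom (ext_mapP f))
    ext_functor_subproof.1 ext_functor_subproof.2.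

Lemma ext_quandle (X : cocycle_rack A) :
  is_quandle (ext_rack X) <->
  is_quandle X /\ (forall r : X, cr_cocycle X r r = 1).
Proof.
split=> [qX|[qX c1] [r a]]; last first.
  rewrite /= ext_opE /= qX; congr (_, _); apply: val_inj.
  by rewrite /= c1 mul1r.
(* The second coordinate of (r,1)^(r,1) = (r,1) is c(r,r) = 1. *)
have q1 r : ext_op X (r, exist _ 1 (rpred1 A)) (r, exist _ 1 (rpred1 A)) =
    (r, exist _ 1 (rpred1 A)) by exact: qX.
split=> r; first by have /(congr1 fst) := q1 r.
by have /(congr1 (fun p => val p.2)) := q1 r; rewrite /= mulr1.
Qed.

End Extension.

(** * Braided morphisms out of a rack space *)

(** Both sides of the condition are linear on the tensor square, so basis tensors
    suffice. *)
Lemma rack_braided_morphismP (K : fieldType) (R : rack) (c : cocycle K R)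
    (V : braided_space K) (f : {linear rack_space c -> V}) :
  braided_morphism f <->
  forall r s : R,
    braiding V (tens (f (rack_basis c r)) (f (rack_basis c s))) =
    c r s *: tens (f (rack_basis c s)) (f (rack_basis c (rack_op r s))).
Proof.
have lhsE r s : (braiding V \o tmap f f)
    (tens (rack_basis c r) (rack_basis c s)) =
    braiding V (tens (f (rack_basis c r)) (f (rack_basis c s))).
  by rewrite /= tmapE.
have rhsE r s : (tmap f f \o braiding (rack_space c))
    (tens (rack_basis c r) (rack_basis c s)) =
    c r s *: tens (f (rack_basis c s)) (f (rack_basis c (rack_op r s))).
  by rewrite /= rack_braidingE linearZ_LR /= tmapE.
split=> [fB r s|fB].
  by rewrite -lhsE -rhsE; apply: fB.
apply: tensor_malg_ext => r s.
exact: etrans (lhsE r s) (etrans (fB r s) (esym (rhsE r s))).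
Qed.

(** On the right, substitute u a for a: the factor u^-1 of (u a)^-1 cancels u. *)
Lemma sum_inv_shift (K : fieldType) (A : divClosed K) (A_N0 : 0 \notin A)
    (A_fin : finite_set [set: {a : K | a \in A}]%classic)
    (V : lmodType K) (u : {a : K | a \in A}) (x : {a : K | a \in A} -> V) :
  \sum_(a \in [set: {a : K | a \in A}]%classic)
     (val a)^-1 *: x (subgroup_mul u a) =
  val u *: \sum_(a \in [set: {a : K | a \in A}]%classic) (val a)^-1 *: x a.
Proof.
rewrite [in RHS](reindex_fsbigT (subgroup_mul u) _ (subgroup_mul_bij A_N0 u)).
rewrite !fsbig_finite // scaler_sumr; apply: eq_bigr => a _.
by rewrite scalerA /= invfM mulrA mulfV ?mul1r ?subgroup_neq0.
Qed.

Lemma tensZZ (K : fieldType) (V W : lmodType K) (a b : K) (v : V) (w : W) :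
  tens (a *: v) (b *: w) = (a * b) *: tens v w.
Proof. by rewrite linearZl_LR linearZr_LR /= scalerA. Qed.

(** Relations of the form T (v (x) w) = w (x) v', where T moves w to the left
    unchanged, are stable under rescaling and under sums. *)
Section Swap.
Variables (K : fieldType) (V : lmodType K).
Variables (T : {linear tensor V V -> tensor V V}).

(** Rescaling v absorbs the scalar c into the second tensor factor: this turns
    a braiding relation with a cocycle into one without.  The rescaled vectors
    x, y, z enter through equations because for the intended use they are
    values of a linear map, equal to multiples of v, w, v' only
    propositionally. *)
Lemma scale_swap (c a b : K) (v w v' x y z : V) :
    T (tens v w) = c *: tens w v' ->
    x = a *: v -> y = b *: w -> z = (c * a) *: v' ->
  T (tens x y) = tens y z.
Proof.
move=> Tvw -> -> ->; rewrite !tensZZ linearZ_LR /= Tvw scalerA.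
by congr (_ *: _); rewrite [RHS]mulrC mulrAC [c * a]mulrC.
Qed.

Variables (I : choiceType) (D : set I) (k : I -> K) (x y : I -> V).
Hypothesis D_fin : finite_set D.

Lemma fsbig_swapr (v w : V) :
    (forall i, T (tens v (x i)) = tens (x i) w) ->
  T (tens v (\sum_(i \in D) k i *: x i)) = tens (\sum_(i \in D) k i *: x i) w.
Proof.
move=> Tx; rewrite !fsbig_finite // linear_sumr linear_sum linear_sumlz.
by apply: eq_bigr => i _; rewrite linearZr_LR linearZ_LR linearZl_LR /= Tx.
Qed.

Lemma fsbig_swapl (w : V) :
    (forall i, T (tens (x i) w) = tens w (y i)) ->
  T (tens (\sum_(i \in D) k i *: x i) w) = tens w (\sum_(i \in D) k i *: y i).
Proof.
move=> Tx; rewrite !fsbig_finite // linear_sumlz linear_sum linear_sumr.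
by apply: eq_bigr => i _; rewrite linearZl_LR linearZ_LR linearZr_LR /= Tx.
Qed.

End Swap.

(** * The embedding iota and the extension of morphisms along it *)

Section Embedding.
Variables (K : fieldType) (A : divClosed K) (A_N0 : 0 \notin A).
Hypothesis A_fin : finite_set [set: {a : K | a \in A}]%classic.
Variable X : cocycle_rack A.

Local Notation At := {a : K | a \in A}.
Local Notation c := (cr_cocycle X).
Local Notation R_c := (ext_rack A_N0 X).
Local Notation e r := (rack_basis c r).
Local Notation E p := (rack_basis (trivial_cocycle K R_c) p).

Definition ext_embed :
    {linear rack_space c -> rack_space (trivial_cocycle K R_c)} :=
  malg_lift (fun r : X =>
    \sum_(a \in [set: At]%classic) (val a)^-1 *: E (r, a)).

Lemma ext_embedE r :
  ext_embed (e r) = \sum_(a \in [set: At]%classic) (val a)^-1 *: E (r, a).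
Proof. exact: malg_liftU. Qed.

Lemma ext_embed_shift r (u : At) :
  val u *: ext_embed (e r) =
  \sum_(a \in [set: At]%classic) (val a)^-1 *: E (r, subgroup_mul u a).
Proof.
rewrite ext_embedE; apply/esym.
exact: (sum_inv_shift A_N0 A_fin u (fun a => E (r, a))).
Qed.

(** The braiding of K R_c moves (s,b) to the left unchanged, and its effect on
    (r,a) depends on s but not on b, so (r,a) passes through the whole sum
    iota(s). *)
Lemma braiding_ext_embed r s (a : At) :
  braiding (rack_space (trivial_cocycle K R_c))
    (tens (E (r, a)) (ext_embed (e s))) =
  tens (ext_embed (e s)) (E (rack_op r s, subgroup_mul (cocycle_elt r s) a)).
Proof.
rewrite ext_embedE; apply: fsbig_swapr => // b.
by rewrite /= rack_braidingE scale1r /= ext_opE.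
Qed.

Lemma ext_embed_braided : braided_morphism ext_embed.
Proof.
apply/rack_braided_morphismP => r s.
rewrite -linearZr_LR /= (ext_embed_shift _ (cocycle_elt r s)).
rewrite [in LHS](ext_embedE r).
by apply: fsbig_swapl => // a; apply: braiding_ext_embed.
Qed.

(** Linearity of the value in a makes the shift of a by c(r,s) act as the scalar
    c(r,s), and 1 / |A| normalises the composite with iota. *)
Definition ext_retract (V : lmodType K) (h : {linear rack_space c -> V}) :
    {linear rack_space (trivial_cocycle K R_c) -> V} :=
  malg_lift (fun p : R_c =>
   (val p.2 / (size (fset_set [set: At]%classic))%:R) *: h (e p.1)).

Lemma ext_retractE (V : lmodType K) (h : {linear rack_space c -> V}) r a :
  ext_retract h (E (r, a)) =
  (val a / (size (fset_set [set: At]%classic))%:R) *: h (e r).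
Proof. exact: malg_liftU. Qed.

Lemma ext_retractK (V : lmodType K) (h : {linear rack_space c -> V}) :
  ext_retract h \o ext_embed =1 h.
Proof.
apply: malg_linear_ext => r; rewrite -[<< r >>]/(e r).
rewrite [LHS]/= ext_embedE fsbig_finite // linear_sum /=.
pose n : K := (size (fset_set [set: At]%classic))%:R.
rewrite (eq_bigr (fun=> n^-1 *: h (e r))) => [|a _]; last first.
  rewrite linearZ_LR /= ext_retractE scalerA mulrA.
  by rewrite mulVf ?mul1r ?subgroup_neq0.
rewrite big_const_seq count_predT iter_addr_0 -scaler_nat scalerA.
by rewrite mulfV ?scale1r // card_finite_subgroup_neq0.
Qed.

(** The second coordinate of (r,a)^(s,b) is c(r,s) a, so the extension of h
    sees the factor c(r,s) although the braiding of K R_c carries no scalar. *)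
Lemma ext_retract_braided (V : braided_space K)
    (h : {linear rack_space c -> V}) :
  braided_morphism h -> braided_morphism (ext_retract h).
Proof.
move/rack_braided_morphismP => hB; apply/rack_braided_morphismP => -[r a] [s b].
have opE : rack_op ((r, a) : R_c) (s, b) =
    (rack_op r s, subgroup_mul (cocycle_elt r s) a) by exact: ext_opE.
rewrite opE; apply: etrans (esym (scale1r _)).
apply: (scale_swap (hB r s) (ext_retractE h r a) (ext_retractE h s b)).
by apply: etrans (ext_retractE h _ _) _; rewrite /= mulrA.
Qed.

(** The extension of the identity is a left inverse. *)
Lemma ext_embed_inj : injective ext_embed.
Proof.
apply: (@can_inj _ _ _ (ext_retract (@idfun (rack_space c)))).
exact: ext_retractK.
Qed.

End Embedding.

Theorem proposition5p1p25 (K : fieldType) (A : divClosed K) (A_N0 : 0 \notin A) :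
  exists ext_rackP : forall X : cocycle_rack A, is_rack (ext_op X),
  let ext (X : cocycle_rack A) : rack := Rack (ext_rackP X) in
  [/\ exists F : functor (cocycle_rack_cat A) rack_cat,
        forall X : cocycle_rack A, F X = ext X,
      forall X : cocycle_rack A,
        is_quandle (ext X) <->
        is_quandle X /\ (forall r : X, cr_cocycle X r r = 1)
    & finite_set [set: {a : K | a \in A}]%classic ->
      forall X : cocycle_rack A,
      exists iota : {linear rack_space (cr_cocycle X) ->
                            rack_space (trivial_cocycle K (ext X))},
      [/\ injective iota,
          braided_morphism iota,
          forall r : X, iota (rack_basis (cr_cocycle X) r) =
            \sum_(a \in [set: {a : K | a \in A}]%classic)
              (val a)^-1 *: rack_basis (trivial_cocycle K (ext X)) (r, a)
        & forall (V : braided_space K)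
                 (h : {linear rack_space (cr_cocycle X) -> V}),
            braided_morphism h ->
            exists h' : {linear rack_space (trivial_cocycle K (ext X)) -> V},
              braided_morphism h' /\ h' \o iota =1 h]].
Proof.
exists (@ext_rackP K A A_N0); split.
- by exists (ext_functor A_N0).
- exact: ext_quandle.
move=> A_fin X; exists (ext_embed A_N0 X); split.
- exact: ext_embed_inj.
- exact: ext_embed_braided.
- exact: ext_embedE.
move=> V h hB; exists (ext_retract A_N0 h); split.
- exact: ext_retract_braided.
- exact: ext_retractK.
Qed.
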